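(* For any weighted graph $G$ and a subset $S$ of its vertices, there exists a collection of shortest paths in $G$ between all pairs of vertices from $S$ (one shortest path for each unordered pair of distinct vertices of $S$) that results in at most $$\binom{|S|}{2}\cdot\left(\binom{|S|}{2}-1\right)$$ crossing vertices outside $S$.
   Context: Graphs are finite and undirected, with non-negative edge weights. A shortest path between two vertices is a path of minimum total weight between them. A crossing vertex of two paths $P_1$ and $P_2$ is an endpoint of a maximal path shared by $P_1$ and $P_2$ (a maximal common subpath, possibly consisting of a single vertex). A vertex is a crossing vertex of a collection of paths if it is a crossing vertex of some pair of paths from the collection.
   Formalization: If two vertices of S lie in different components of G, no path joins them and the required collection does not exist; the formal statement gives one shortest path for each pair of distinct vertices of S that is joined by a path in G, with the same bound. *)

(* Defs.v *)
From mathcomp Require Import all_boot all_order all_algebra.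
From mathcomp Require Import boolp.

Set Implicit Arguments.
Unset Strict Implicit.
Unset Printing Implicit Defensive.

Import Order.TTheory GRing.Theory Num.Theory.
Local Open Scope ring_scope.

Record wgraph (R : realDomainType) := WGraph {
  vertex :> finType;
  adj : rel vertex;
  weight : vertex -> vertex -> R;  (* only meaningful on adjacent vertices *)
  adj_sym : symmetric adj;
  adj_irr : irreflexive adj;
  weight_sym : forall x y, adj x y -> weight x y = weight y x;
  weight_ge0 : forall x y, adj x y -> 0 <= weight x y
}.

(* An undirected path is represented by the sequence of its vertices, read in
   either of its two directions: p and rev p stand for the same path, and
   on paths every notion below is invariant under rev. *)

Definition gpath (R : realDomainType) (G : wgraph R) (p : seq G) : bool :=
  [&& p != [::], sorted (@adj R G) p & uniq p].

Definition endpoints (R : realDomainType) (G : wgraph R) (p : seq G) :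
    {set G} :=
  [set v | (ohead p == Some v) || (ohead (rev p) == Some v)].

(* zip drops the unmatched last vertex, so the sum is over the edges of p. *)
Definition path_weight (R : realDomainType) (G : wgraph R) (p : seq G) : R :=
  \sum_(xy <- zip p (behead p)) weight xy.1 xy.2.

Definition shortest_path (R : realDomainType) (G : wgraph R) (A : {set G})
    (p : seq G) : Prop :=
  [/\ gpath p, endpoints p = A &
      forall q : seq G, gpath q -> endpoints q = A ->
        path_weight p <= path_weight q].

Definition subpath (R : realDomainType) (G : wgraph R) (q p : seq G) : bool :=
  gpath q && (infix q p || infix (rev q) p).

Definition maximal_shared_path (R : realDomainType) (G : wgraph R)
    (p1 p2 q : seq G) : Prop :=
  [/\ subpath q p1, subpath q p2 &
      forall q' : seq G, subpath q' p1 -> subpath q' p2 ->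
        subpath q q' -> subpath q' q].

Definition crossing_vertex (R : realDomainType) (G : wgraph R)
    (p1 p2 : seq G) (v : G) : Prop :=
  exists2 q : seq G, maximal_shared_path p1 p2 q & v \in endpoints q.

(* The unordered pairs of distinct vertices of S that are joined by a path of
   G; these are all the pairs of S as soon as G is connected. *)
Definition joined_pairs (R : realDomainType) (G : wgraph R) (S : {set G}) :
    {set {set G}} :=
  [set A : {set G} | [&& A \subset S, #|A| == 2 &
    [forall x in A, forall y in A, connect (@adj R G) x y]]].

(* P assigns to each unordered pair A in D the path P A. *)
Definition crossing_vertices (R : realDomainType) (G : wgraph R)
    (D : {set {set G}}) (P : {set G} -> seq G) : {set G} :=
  [set v | `[< exists A B : {set G},
    [/\ A \in D, B \in D, A != B & crossing_vertex (P A) (P B) v] >]].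

(* Main.v *)
(* Break ties between paths of equal weight by a generic edge weight (distinct
   powers of two). Shortest paths then become unique, and so are their
   subpaths, hence two chosen paths that meet at x and y coincide between x and
   y. So they share at most one maximal path, which contributes at most two
   crossing vertices, and there are 'C(N, 2) pairs of paths for N the number of
   pairs of S. *)
Require Import Defs.
From mathcomp Require Import all_boot all_order all_algebra.

Set Implicit Arguments.
Unset Strict Implicit.
Unset Printing Implicit Defensive.

Import Order.TTheory GRing.Theory Num.Theory.

(** * Uniqueness of binary expansions *)

Lemma sum_pow2_inj (n : nat) (P Q : nat -> bool) :
  \sum_(i < n) P i * 2 ^ i = \sum_(i < n) Q i * 2 ^ i ->
  forall i, i < n -> P i = Q i.
Proof.
elim: n P Q => [//|n IHn] P Q.
have split_low (P' : nat -> bool) : \sum_(i < n.+1) P' i * 2 ^ i =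
    P' 0 + (\sum_(i < n) P' i.+1 * 2 ^ i).*2.
  rewrite big_ord_recl expn0 muln1 -muln2 big_distrl /=; congr (_ + _).
  by apply: eq_bigr => i _; rewrite /bump /= add1n expnS mulnCA mulnC.
rewrite !split_low => E.
(* Parity isolates the lowest digit. Once it is cancelled, halving leaves the shifted digits to the
   induction hypothesis. *)
have P0 : P 0 = Q 0.
  by move/(congr1 odd): E; rewrite !oddD !odd_double !addbF !oddb.
move: E; rewrite P0 => /addnI /double_inj E [//|i]; rewrite ltnS.
exact: (IHn (fun i => P i.+1) (fun i => Q i.+1)).
Qed.

(** * Edges and infixes of sequences *)

Section Seq.
Variable T : eqType.
Implicit Types (p q s m : seq T) (x y : T) (a : pred T).

Definition edges p := zip p (behead p).

Lemma edges_cat s1 x s2 :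
  edges (s1 ++ x :: s2) = edges (rcons s1 x) ++ edges (x :: s2).
Proof.
elim: s1 => //= y [|z s1] //= IHs.
by rewrite /edges /= in IHs *; rewrite IHs.
Qed.

Lemma edges_rev p : edges (rev p) = rev [seq (e.2, e.1) | e <- edges p].
Proof.
elim: p => // x [|y s] // IHs.
have -> : rev [:: x, y & s] = rev s ++ y :: [:: x].
  by rewrite !rev_cons -!cats1 -catA.
by rewrite edges_cat -rev_cons IHs [RHS]rev_cons -cats1.
Qed.

Lemma sorted_edges (e : rel T) p :
  sorted e p = all (fun xy => e xy.1 xy.2) (edges p).
Proof. by case: p => // x s; elim: s x => //= y s IHs x; rewrite IHs. Qed.

(** An occurrence of a nonempty [q] cannot start inside [s1], since its first element would lie
    there. Reversal turns [s2] into a prefix, to which the same argument applies. *)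
Lemma infix_disjoint q s1 m s2 :
  ~~ has (mem q) s1 -> ~~ has (mem q) s2 -> infix q (s1 ++ m ++ s2) ->
  infix q m.
Proof.
have drop_left q' s m' : ~~ has (mem q') s -> infix q' (s ++ m') -> infix q' m'.
  elim: s => //= z s IHs; rewrite negb_or => /andP[zq sq].
  move=> /orP[|/IHs -> //].
  case: q' zq {IHs sq} => [|z' q'] /=; first by rewrite infix0s.
  by rewrite inE negb_or => /andP[/negPf]; rewrite eq_sym => ->.
move=> q1 q2 /drop_left -/(_ q1); rewrite -infix_rev rev_cat => /drop_left.
rewrite infix_rev; apply; rewrite has_rev.
apply: contra q2 => /hasP[z zs zq]; apply/hasP; exists z => //=.
by rewrite /= mem_rev in zq.
Qed.

Lemma infix_size_eq p q : infix p q -> size q <= size p -> p = q.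
Proof.
move=> /infixP[s1 [s2 ->]]; rewrite !size_cat.
rewrite addnCA -[leqRHS]addn0 leq_add2l leqn0 addn_eq0 !size_eq0.
by move=> /andP[/eqP -> /eqP ->]; rewrite cats0.
Qed.

(** Meant for [a] being membership in a second path: [x :: m] then runs from the first to the last
    common vertex, which may coincide. *)
Lemma has_first_last a p : has a p ->
  exists s1 x m s2, [/\ p = s1 ++ (x :: m) ++ s2, a x, a (last x m),
                        ~~ has a s1 & ~~ has a s2].
Proof.
elim: p => //= x s IHs; case: (boolP (a x)) => /= ax => [_|/IHs].
  suff [m [s2 [-> am an]]] : exists m s2,
      [/\ s = m ++ s2, a (last x m) & ~~ has a s2].
    by exists [::], x, m, s2.
  elim/last_ind: s {IHs} => [|s y [m [s2 [-> am an]]]].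
    by exists [::], [::].
  case: (boolP (a y)) => ay.
    by exists (rcons (m ++ s2) y), [::]; rewrite cats0 last_rcons.
  by exists m, (rcons s2 y); rewrite rcons_cat has_rcons negb_or ay.
move=> [s1 [y [m [s2 [-> ay am n1 n2]]]]].
by exists (x :: s1), y, m, s2; rewrite /= negb_or ax.
Qed.

Lemma infix_between p x y : x \in p -> y \in p ->
  exists2 m, infix m p &
    (ohead m == Some x) && (last x m == y) ||
    (ohead m == Some y) && (last y m == x).
Proof.
move=> /splitPr[t1 t2]; rewrite mem_cat orbC => /orP[/splitPl[s s2 <-]|].
  exists (x :: s); last by rewrite /= !eqxx.
  by apply/infixP; exists t1, s2.
move=> /splitPr[s s2]; exists (y :: rcons s2 x).
  by apply/infixP; exists s, t2; rewrite -!catA /= cat_rcons.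
by rewrite /= last_rcons !eqxx orbT.
Qed.

End Seq.

(** * Comparison of paths by weight, then by tie-breaker *)

Section Graph.
Variables (R : realDomainType) (G : wgraph R).
Implicit Types (p q s m : seq G) (x y v : G).
Local Notation adj := (@adj R G).

Definition edge_sets p : seq {set G} := [seq [set e.1; e.2] | e <- edges p].

(* Distinct edges get distinct powers of two, so that on simple paths the sum
   determines the set of edges. *)
Definition tie p : nat := \sum_(e <- edge_sets p) 2 ^ enum_rank e.

(** The lexicographic order on (weight, tie) stands for an infinitesimal perturbation of the
    weights, so no small real number has to be chosen. *)
Definition cheaper p q : bool :=
  (path_weight p < path_weight q)%R ||
  (path_weight p == path_weight q) && (tie p <= tie q).

Lemma cheaper_refl : reflexive cheaper.
Proof. by move=> p; rewrite /cheaper eqxx leqnn orbT. Qed.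

Lemma cheaper_trans : transitive cheaper.
Proof.
move=> q p r /orP[pq|/andP[/eqP pq tpq]] /orP[qr|/andP[/eqP qr tqr]];
  rewrite /cheaper.
- by rewrite (lt_trans pq qr).
- by rewrite -qr pq.
- by rewrite pq qr.
- by rewrite pq qr eqxx (leq_trans tpq tqr) orbT.
Qed.

Lemma cheaper_total : total cheaper.
Proof.
by move=> p q; rewrite /cheaper; case: ltgtP => //= _; exact: leq_total.
Qed.

Lemma cheaper_weight p q : cheaper p q -> (path_weight p <= path_weight q)%R.
Proof. by case/orP=> [/ltW//|/andP[/eqP->]]. Qed.

(** * Directed walks, replacement of a piece, and removal of loops *)

Definition walk x y p := [&& ohead p == Some x, last x p == y & sorted adj p].

Lemma walkP x y p :
  reflect (exists s, [/\ p = x :: s, last x s = y & path adj x s]) (walk x y p).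
Proof.
case: p => [|z s]; first by apply: (iffP idP) => // -[s []].
apply: (iffP and3P) => [[/eqP[->] /eqP/= <- H]|[_ [[-> <-] /= <- ->]]];
  by [exists s | rewrite !eqxx].
Qed.

Lemma walk_rev x y p : walk x y p -> walk y x (rev p).
Proof.
move=> /walkP[s [-> <- xs]]; apply/and3P; split.
- by rewrite lastI rev_rcons.
- by rewrite rev_cons last_rcons.
- rewrite rev_sorted.
  by rewrite (@eq_sorted _ _ adj) // => u v; exact: adj_sym.
Qed.

Lemma edges_walk x y p s1 s2 : walk x y p ->
  edges (s1 ++ p ++ s2) =
    edges (rcons s1 x) ++ edges p ++ edges (y :: s2).
Proof.
move=> /walkP[s [-> <- _]].
by rewrite edges_cat -cat_cons lastI cat_rcons edges_cat.
Qed.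

Lemma path_weightE p : path_weight p = (\sum_(e <- edges p) weight e.1 e.2)%R.
Proof. by []. Qed.

Lemma tieE p : tie p = \sum_(e <- edges p) 2 ^ enum_rank [set e.1; e.2].
Proof. by rewrite /tie big_map. Qed.

Lemma path_weight_rev p : sorted adj p -> path_weight (rev p) = path_weight p.
Proof.
rewrite sorted_edges !path_weightE edges_rev => /allP pe.
rewrite (perm_big _ (permEl (perm_rev _))) /= big_map.
by apply: eq_big_seq => e /pe /= ee; rewrite (weight_sym ee).
Qed.

Lemma tie_rev p : tie (rev p) = tie p.
Proof.
rewrite !tieE edges_rev (perm_big _ (permEl (perm_rev _))) /= big_map.
by apply: eq_bigr => e _; rewrite setUC.
Qed.

(** Both costs are additive over edges, and the edges outside the middle piece, including those that
    attach it, depend only on its ends [x] and [y]; their contribution cancels. *)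
Lemma cheaper_walk x y p q s1 s2 : walk x y p -> walk x y q ->
  cheaper (s1 ++ p ++ s2) (s1 ++ q ++ s2) = cheaper p q.
Proof.
move=> wp wq; rewrite /cheaper !path_weightE !tieE.
rewrite (edges_walk s1 s2 wp) (edges_walk s1 s2 wq) !big_cat /=.
rewrite ltrD2l ltrD2r (inj_eq (addrI _)) (inj_eq (addIr _)).
by rewrite leq_add2l leq_add2r.
Qed.

(** Non-negativity of the weights enters here; an added edge of weight zero still cannot lower the
    tie. *)
Lemma cheaper_cons x p : sorted adj (x :: p) -> cheaper p (x :: p).
Proof.
case: p => [_|y s /= /andP[xy _]]; first exact: (cheaper_refl [::]).
rewrite /cheaper !path_weightE !tieE /edges /= !big_cons /=.
have := weight_ge0 xy; rewrite le_eqVlt => /orP[/eqP<-|w0].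
  by rewrite add0r eqxx leq_addl orbT.
by rewrite ltrDr w0.
Qed.

Lemma cheaper_suffix s1 p : sorted adj (s1 ++ p) -> cheaper p (s1 ++ p).
Proof.
elim: s1 => [|x s1 IHs] H; first exact: cheaper_refl.
apply: cheaper_trans (IHs _) (cheaper_cons H).
exact: path_sorted H.
Qed.

(** The tail is made simple by induction. If [x] recurs in it, the loop before that recurrence is
    cut off, and dropping a prefix never raises the cost. *)
Lemma simple_walk x y p : walk x y p ->
  exists q, [/\ walk x y q, uniq q & cheaper q p].
Proof.
move=> /walkP[s [-> <- {p y}]].
elim: s x => [|z s IHs] x /=.
  by move=> _; exists [:: x]; rewrite cheaper_refl /walk /= !eqxx.
move=> /andP[xz zs]; have [q [wq uq cq]] := IHs _ zs.
have wxs : walk x z [:: x; z] by rewrite /walk /= !eqxx xz.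
have [u [Eq lu zu]] := walkP _ _ _ wq.
have wxq : walk x (last z s) (x :: q).
  by apply/walkP; exists q; rewrite Eq /= lu xz.
have cxq : cheaper (x :: q) [:: x, z & s].
  have wzs : walk z (last z s) (z :: s).
    by apply/walkP; exists s.
  by have := cheaper_walk [:: x] [::] wq wzs; rewrite !cats0 /= => ->.
have [xq|xq] := boolP (x \in q); last by exists (x :: q); rewrite /= xq.
case/splitPr: xq uq cxq wxq => s1 s2 uq cxq /and3P[_ /eqP lxq sxq].
exists (x :: s2); split.
- move: lxq sxq; rewrite -cat_cons last_cat /= => lxq; rewrite cat_path /=.
  by move=> /and3P[_ _ sx]; apply/walkP; exists s2.
- by move: uq; rewrite cat_uniq => /and3P[].
- by apply: cheaper_trans cxq; exact: (cheaper_suffix (s1 := x :: s1)).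
Qed.

(** * Optimal walks: existence, reversal, and infixes *)

Definition optimal x y p :=
  [/\ walk x y p, uniq p & forall q, walk x y q -> cheaper p q].

(** Simple walks have at most [#|G|] vertices, so they form a finite set, on which the total
    preorder [cheaper] has a minimum. By [simple_walk] it is a minimum among all walks. *)
Lemma exists_optimal x y : connect adj x y -> exists p, optimal x y p.
Proof.
have small p : uniq p -> size p <= #|G|.
  by move=> /card_uniqP <-; exact: max_card.
move=> /connectP[s xs ys].
have [] := @simple_walk x y (x :: s); first by apply/walkP; exists s.
move=> p0 [wp0 up0 _].
pose F (b : #|G|.-bseq G) : seq G := b.
pose P b := walk x y (F b) && uniq (F b).
have Pp0 : P (Bseq (small _ up0)) by rewrite /P wp0.
have [] := @extremumP _ _ cheaper _ P F
  cheaper_refl cheaper_trans cheaper_total Pp0.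
move=> b /andP[wb ub] bmin; exists b; split=> // q /simple_walk[r [wr ur rq]].
apply: cheaper_trans rq.
by apply: (bmin (Bseq (small _ ur))); rewrite /P wr.
Qed.

Lemma optimal_rev x y p : optimal x y p -> optimal y x (rev p).
Proof.
move=> [wp up pmin]; split; [exact: walk_rev | by rewrite rev_uniq |] => q wq.
have := pmin _ (walk_rev wq).
have sq : sorted adj q by case/and3P: wq.
have sp : sorted adj p by case/and3P: wp.
by rewrite /cheaper !tie_rev !path_weight_rev.
Qed.

(** Exchange argument: a walk [r] replacing [q] inside [p] gives a competitor of [p]. It may repeat
    vertices, which is why [optimal] compares with all walks and not only simple ones. *)
Lemma optimal_infix a b p x y q :
  optimal a b p -> infix q p -> walk x y q -> optimal x y q.
Proof.
move=> [wp up pmin] /infixP[s1 [s2 Ep]] wq; split=> //.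
  move: up; rewrite Ep cat_uniq => /and3P[_ _].
  by rewrite cat_uniq => /and3P[].
move=> r wr; rewrite -(cheaper_walk s1 s2 wq wr) -Ep; apply: pmin.
(* It remains to see that the exchanged sequence is a walk from [a] to [b]; its edges come from [p]
   and from [r]. *)
move: wp; rewrite Ep /walk !sorted_edges.
rewrite (edges_walk s1 s2 wq) (edges_walk s1 s2 wr).
rewrite !all_cat -!sorted_edges.
have /and3P[_ _ ->] := wr => /and3P[ha la /and3P[-> _ ->]].
rewrite andbT; move: ha la.
have [s [-> ls _]] := walkP _ _ _ wq; have [s' [-> ls' _]] := walkP _ _ _ wr.
case: s1 {Ep} => [|z s1] /= -> /=;
  by rewrite !last_cat /= ?last_cat /= ls ls' => ->.
Qed.

(** * Recovery of a simple path from its edge set *)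

Lemma mem_edge_sets p e x : e \in edge_sets p -> x \in e -> x \in p.
Proof.
case: p => // z s; elim: s z => //= y s IHs z.
rewrite inE => /orP[/eqP->|/IHs H /H]; last by rewrite [x \in z :: _]in_cons => ->; rewrite orbT.
by rewrite !inE /= => /orP[]->; rewrite ?orbT.
Qed.

Lemma edge_sets_uniq p : uniq p -> uniq (edge_sets p).
Proof.
case: p => // x s; elim: s x => // y s IHs x; rewrite cons_uniq => /andP[xs us].
rewrite /edge_sets /edges /= -/(edges (y :: s)) -/(edge_sets (y :: s)).
rewrite IHs // andbT.
by apply: contra xs => /mem_edge_sets; apply; rewrite set21.
Qed.

(** On a simple path the start lies on the first edge only, so the edge set determines the second
    vertex; the rest follows by induction. *)
Lemma edge_sets_inj x s s' : uniq (x :: s) -> uniq (x :: s') ->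
  edge_sets (x :: s) =i edge_sets (x :: s') -> s = s'.
Proof.
have headE u v t :
  edge_sets [:: u, v & t] = [set u; v] :: edge_sets (v :: t) by [].
elim: s x s' => [|y s IHs] x [|z s'] //.
- by move=> _ _ /(_ [set x; z]); rewrite headE mem_head.
- by move=> _ _ /(_ [set x; y]); rewrite headE mem_head.
rewrite !headE [uniq _]/= [uniq (x :: _)]/= => /andP[xy uy] /andP[xz uz] E.
have yz : y = z.
  have: [set x; y] \in [set x; z] :: edge_sets (z :: s') by rewrite -E mem_head.
  rewrite inE => /orP[/eqP/setP/(_ y)|/mem_edge_sets/(_ (set21 x y))]; last first.
    by rewrite (negPf xz).
  rewrite set22 => /esym /set2P[yx|//].
  by rewrite yx mem_head in xy.
rewrite -{}yz in xz uz E *; congr (_ :: _); apply: (IHs y) => // e.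
(* The first edge contains [x] and hence is absent from both tails, so it can be cancelled from
   [E]. *)
have x_free t : x \notin y :: t -> e \in edge_sets (y :: t) ->
    (e == [set x; y]) = false.
  move=> xt et; apply: contraNF xt => /eqP Ee.
  by apply: (mem_edge_sets et); rewrite Ee set21.
apply/idP/idP => ee; have := E e; rewrite !inE ee orbT (x_free _ _ ee) //=.
Qed.

(** A simple path repeats no edge, so the binary digits of its tie are the indicator of its edge
    set. The common start fixes the direction. *)
Lemma tie_inj x p q : uniq p -> uniq q -> ohead p = Some x ->
  ohead q = Some x -> tie p = tie q -> p = q.
Proof.
have tieE' r : uniq r -> tie r =
    \sum_(i < #|{set G}|) (nth set0 (enum {set G}) i \in edge_sets r) * 2 ^ i.
  move=> ur; rewrite /tie big_uniq ?edge_sets_uniq //= big_mkcond /=.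
  rewrite (reindex _ (onW_bij _ (enum_val_bij _))) /=.
  apply: eq_bigr => i _; rewrite enum_valK (enum_val_nth set0).
  by case: ifP; rewrite ?mul1n.
move=> up uq hp hq; rewrite (tieE' _ up) (tieE' _ uq).
pose rank_in r (i : nat) := nth set0 (enum {set G}) i \in edge_sets r.
move=> /(@sum_pow2_inj _ (rank_in p) (rank_in q)) E.
have {}E : edge_sets p =i edge_sets q.
  move=> e; have := E _ (ltn_ord (enum_rank e)).
  by rewrite /rank_in nth_enum_rank.
case: p q hp hq up uq E => // x1 s [|x2 s'] // [->] [->] us us' E.
by rewrite (edge_sets_inj us us' E).
Qed.

Lemma optimal_unique x y p q : optimal x y p -> optimal x y q -> p = q.
Proof.
move=> [wp up pmin] [wq uq qmin].
have := qmin _ wp; have := pmin _ wq; rewrite /cheaper.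
case: ltgtP => //= _ pq qp.
apply: (@tie_inj x) => //; first by case/and3P: wp => /eqP.
  by case/and3P: wq => /eqP.
by apply/eqP; rewrite eqn_leq pq.
Qed.

(** * Endpoints, and crossing vertices of two optimal paths *)

Lemma endpoints_walk x y p : walk x y p -> endpoints p = [set x; y].
Proof.
move=> /walkP[s [-> <- _]]; apply/setP => v.
by rewrite !inE lastI rev_rcons -lastI /= !(inj_eq Some_inj) ![v == _]eq_sym.
Qed.

Lemma mem_endpoints v p : v \in endpoints p -> v \in p.
Proof.
have head_mem s : ohead s == Some v -> v \in s.
  by case: s => //= z s /eqP[->]; rewrite mem_head.
by rewrite inE => /orP[] /head_mem; rewrite ?mem_rev.
Qed.

Lemma endpoints_rev p : endpoints (rev p) = endpoints p.
Proof. by apply/setP => v; rewrite !inE revK orbC. Qed.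

Lemma optimal_shortest x y p : x != y -> optimal x y p ->
  shortest_path [set x; y] p.
Proof.
move=> xy [wp up pmin]; split; [|exact: endpoints_walk|].
  by apply/and3P; case/and3P: wp => h _ ->; split=> //; case: p h {up pmin}.
move=> q /and3P[q0 sq uq] eq.
have [u [v wuv]] : exists u v, walk u v q.
  case: q q0 sq {uq eq} => // u s _ us.
  by exists u, (last u s); apply/walkP; exists s.
(* Endpoints form an unordered set, so the competitor may run in the opposite direction; reversing
   it preserves the weight. *)
suff [wq|wq] : walk x y q \/ walk y x q; first exact/cheaper_weight/pmin.
  by rewrite -(path_weight_rev sq); apply/cheaper_weight/pmin/walk_rev.
have := set21 x y; have := set22 x y.
rewrite -eq (endpoints_walk wuv) => /set2P[] Ey /set2P[] Ex; subst; auto;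
  by rewrite eqxx in xy.
Qed.

Lemma subpath_size q p : subpath q p -> size q <= size p.
Proof. by case/andP=> _ /orP[] /size_infix; rewrite ?size_rev. Qed.

Lemma subpath_endpoints p q : subpath p q -> subpath q p ->
  endpoints p = endpoints q.
Proof.
move=> pq /subpath_size; case/andP: pq => _ /orP[] pq qp.
  by rewrite (infix_size_eq pq).
by rewrite -(infix_size_eq pq) ?size_rev // endpoints_rev.
Qed.

(** The witnesses are the first and last vertices of [p1] on [p2]. The piece [M] of [p1] between
    them is shared and contains every shared path, so a maximal one is [M] up to direction. *)
Lemma optimal_crossing a b c d p1 p2 : optimal a b p1 -> optimal c d p2 ->
  exists e1 e2, forall v, crossing_vertex p1 p2 v -> v \in [set e1; e2].
Proof.
move=> o1 o2.
have in_path q p : subpath q p -> {subset q <= p}.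
  move=> /andP[_ /orP[/mem_infix//|/mem_infix H]] z zq.
  by apply: H; rewrite mem_rev.
have [/has_first_last|no] := boolP (has (mem p2) p1); last first.
  (* Disjoint paths have no crossing vertex, so the witness is arbitrary. *)
  exists a, a => v [q [/in_path q1 /in_path q2 _]] vq.
  move/mem_endpoints in vq.
  by case/hasP: no; exists v; [apply: q1|apply: q2].
move=> [s1 [x [m [s2 [Ep1 xp2 yp2 n1 n2]]]]].
set y := last x m in yp2.
set M := x :: m in Ep1.
have M1 : infix M p1 by apply/infixP; exists s1, s2.
have wM : walk x y M.
  by apply/and3P; split=> //; apply: (infix_sorted M1); case: o1 => /and3P[].
have oM := optimal_infix o1 M1 wM.
have gM : gpath M by apply/and3P; case: oM => /and3P[].
have sorted_p2 n : infix n p2 -> sorted adj n.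
  by move=> np2; apply: (infix_sorted np2); case: o2 => /and3P[].
have M2 : infix M p2 || infix (rev M) p2.
  (* [p2] may meet [x] and [y] in either order. Its piece between them is optimal, so uniqueness
     identifies it with [M] or [rev M]. *)
  have [n np2 /orP[]/andP[hn ln]] := infix_between xp2 yp2.
  - have wn : walk x y n.
      apply/and3P; split=> //.
      exact: sorted_p2.
    by rewrite (optimal_unique oM (optimal_infix o2 np2 wn)) np2.
  - have wn : walk y x n.
      apply/and3P; split=> //.
      exact: sorted_p2.
    by rewrite (optimal_unique (optimal_rev oM) (optimal_infix o2 np2 wn)) np2 orbT.
exists x, y => v [q [q1 q2 qmax]]; rewrite -(endpoints_walk wM).
(* All vertices of [q] lie on [p2], which [s1] and [s2] avoid, so [q] occurs in [p1] within [M]. *)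
have qM : subpath q M.
  have /andP[gq q1'] := q1; rewrite /subpath gq /=.
  have off s : ~~ has (mem p2) s -> ~~ has (mem q) s.
    apply: contra => /hasP[z zs zq]; apply/hasP; exists z => //=.
    exact: (in_path _ _ q2).
  have off' s : ~~ has (mem q) s -> ~~ has (mem (rev q)) s.
    apply: contra => /hasP[z zs zq]; apply/hasP; exists z => //=.
    by rewrite /= mem_rev in zq.
  case/orP: q1'; rewrite Ep1 => /infix_disjoint H; apply/orP; [left|right];
    by apply: H; rewrite ?off' ?off.
have Mq : subpath M q by apply: qmax; rewrite // /subpath gM ?M1 ?M2.
by rewrite (subpath_endpoints qM Mq).
Qed.

(** * Counting crossing vertices over all pairs of paths *)

Lemma crossing_vertexC p1 p2 v :
  crossing_vertex p1 p2 v -> crossing_vertex p2 p1 v.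
Proof.
move=> [q [q1 q2 qmax] vq]; exists q => //; split=> // q' h1 h2.
exact: qmax.
Qed.

Lemma joined_pairsP (S A : {set G}) : A \in joined_pairs S ->
  exists x y, [/\ A = [set x; y], x != y & connect adj x y].
Proof.
rewrite inE => /and3P[_ /cards2P[x [y [xy ->]]] /forall_inP H].
exists x, y; split=> //.
by have /forall_inP := H x (set21 x y); apply; rewrite set22.
Qed.

Lemma card_joined_pairs (S : {set G}) : #|joined_pairs S| <= 'C(#|S|, 2).
Proof.
rewrite -cards_draws; apply: subset_leq_card.
by apply/subsetP => A; rewrite !inE => /and3P[-> ->].
Qed.

Lemma card_crossing_vertices (D : {set {set G}}) (P : {set G} -> seq G) :
  (forall A, A \in D -> exists x y, optimal x y (P A)) ->
  #|crossing_vertices D P| <= #|D| * (#|D| - 1).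
Proof.
move=> optP.
(* Grouping by the unordered pair [T] counts each pair of paths once; ordered pairs would double the
   bound. *)
pose crossings (T : {set {set G}}) : {set G} := [set v | [exists A, [exists B,
  [&& T == [set A; B], A != B & boolp.asbool (crossing_vertex (P A) (P B) v)]]]].
pose T2 := [set T : {set {set G}} | T \subset D & #|T| == 2].
have sub : crossing_vertices D P \subset \bigcup_(T in T2) crossings T.
  apply/subsetP => v; rewrite inE => /boolp.asboolP[A [B [AD BD AB ABv]]].
  apply/bigcupP; exists [set A; B].
    by rewrite inE subUset !sub1set AD BD cards2 AB.
  rewrite inE; apply/existsP; exists A; apply/existsP; exists B.
  by rewrite eqxx AB; apply/boolp.asboolP.
apply: leq_trans (subset_leq_card sub) _.
have card2 T : T \in T2 -> #|crossings T| <= 2.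
  rewrite inE => /andP[TD /cards2P[A [B [AB ET]]]].
  move: TD; rewrite ET subUset !sub1set.
  move=> /andP[/optP[a [b oA]] /optP[c [d oB]]].
  have [e1 [e2 He]] := optimal_crossing oA oB.
  apply: (@leq_trans #|[set e1; e2]|); last by rewrite cards2; case: eqP.
  apply/subset_leq_card/subsetP => v; rewrite inE => /existsP[A' /existsP[B']].
  move=> /and3P[/eqP/setP E AB' /boolp.asboolP cv]; apply: He.
  have := E A'; have := E B'; rewrite set21 set22.
  move=> /set2P[] EB /set2P[] EA; subst A' B'; rewrite ?eqxx // in AB' *.
  exact: crossing_vertexC.
apply: (@leq_trans (\sum_(T in T2) 2)).
  elim/big_rec2: _ => [|T U n TD IHU]; first by rewrite cards0.
  by apply: leq_trans (leq_card_setU _ _) _; rewrite leq_add ?card2.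
rewrite sum_nat_const cards_draws.
by rewrite -[2 in X in X <= _]/(2`!) bin_ffact ffactnS ffactn1 subn1.
Qed.

End Graph.

Theorem lemma10 (R : realDomainType) (G : wgraph R) (S : {set G}) :
  exists P : {set G} -> seq G,
    (forall A : {set G}, A \in joined_pairs S -> shortest_path A (P A)) /\
    #|crossing_vertices (joined_pairs S) P :\: S|
      <= 'C(#|S|, 2) * ('C(#|S|, 2) - 1).
Proof.
(* Finite choice needs a path for every [A]; outside [joined_pairs S] the empty sequence is a dummy
   value. *)
have /fin_all_exists[P HP] (A : {set G}) : exists p, A \in joined_pairs S ->
    exists x y, [/\ A = [set x; y], x != y & optimal x y p].
  have [/joined_pairsP[x [y [-> xy /exists_optimal[p op]]]]|nA] :=
    boolP (A \in joined_pairs S); last by exists [::].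
  by exists p => _; exists x, y.
exists P; split=> [A /HP[x [y [-> xy op]]]|].
  by have := optimal_shortest xy op.
apply: leq_trans (subset_leq_card (subsetDl _ _)) _.
apply: leq_trans (card_crossing_vertices _) _ => [A /HP[x [y [_ _ op]]]|].
  by exists x, y.
by rewrite leq_mul ?leq_sub2r ?card_joined_pairs.
Qed.
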